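(* Let $K$ be any field, let $p\ge 1$ be an integer, $m=2p+1$, and $D=\binom{m}{p}$. Let $\phi_L:K^m\otimes K^m\otimes K^m\to\operatorname{Mat}_{mD,mD}$ be the linear map $\sum_is_i\otimes X_i\mapsto\sum_iL(s_i)\otimes X_i$, where $L:K^m\to\operatorname{Hom}(\bigwedge^pK^m,\bigwedge^{p+1}K^m)$ is given by $L(v)(w)=v\wedge w$. Let $N=(2m-4)\binom{2p}{p}+1$. Then the $N\times N$ minors of $\phi_L$ (i.e. the functions $T\mapsto$ ($N\times N$ minor of the matrix $\phi_L(T)$), which are polynomials in the coordinates of $T$) vanish on all tensors $T\in K^m\otimes K^m\otimes K^m$ of border rank $\le 2m-4$, and at least one of these minors is a non-trivial (i.e. nonzero) polynomial.
   Context: $\operatorname{Mat}_{r,s}$ is the space of $r\times s$ matrices over $K$. In the definition of $\phi_L$, $s_i\in K^m$ and $X_i\in K^m\otimes K^m$; the space $K^m\otimes K^m$ (the last two factors) is identified with $\operatorname{Mat}_{m,m}$ via $e_j\otimes e_k\leftrightarrow E_{j,k}$; $\operatorname{Hom}(\bigwedge^pK^m,\bigwedge^{p+1}K^m)$ is identified with $\operatorname{Mat}_{D,D}$ via chosen bases; and $\operatorname{Mat}_{D,D}\otimes\operatorname{Mat}_{m,m}$ is identified with $\operatorname{Mat}_{mD,mD}$ by the Kronecker product. The tensor rank of a tensor is the smallest $n$ such that it is a sum of $n$ pure tensors; $Z_n$ is the set of tensors of tensor rank $\le n$, $\overline Z_n$ its Zariski closure; the border rank of $T$ is the smallest $n$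 with $T\in\overline Z_n$. *)

(* Defs.v *)
From HB Require Import structures.
From mathcomp Require Import all_boot all_order all_algebra.
From mathcomp Require Import mxtens.
From mathcomp Require Export mpoly.

Set Implicit Arguments.
Unset Strict Implicit.
Unset Printing Implicit Defensive.

Import GRing.Theory.
Local Open Scope ring_scope.

Section Exterior.
Variables (K : fieldType) (m : nat).

(* The exterior algebra of K^m, in coordinates: u A is the coefficient in u of
   the monomial e_A := e_(i_1) /\ ... /\ e_(i_k), where A = {i_1 < ... < i_k}. *)
Definition extalg := {ffun {set 'I_m} -> K^o}.

Definition ebase (A : {set 'I_m}) : extalg := [ffun B => (B == A)%:R].

Definition inversions (A B : {set 'I_m}) : nat :=
  #|[set x : 'I_m * 'I_m | [&& x.1 \in A, x.2 \in B & (x.2 < x.1)%N]]|.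

(* Bilinear extension of e_S /\ e_T = (-1)^(inversions S T) e_(S :|: T) for
   disjoint S and T, and e_S /\ e_T = 0 otherwise. *)
Definition wedge (u w : extalg) : extalg :=
  [ffun A : {set 'I_m} => \sum_(S in powerset A)
     (-1) ^+ inversions S (A :\: S) * u S * w (A :\: S)].

Definition ext_vec (v : 'rV[K]_m) : extalg := \sum_i v 0 i *: ebase [set i].

Definition extpow (p : nat) : {vspace extalg} :=
  <<[seq ebase A | A in [set A : {set 'I_m} | #|A| == p]]>>%VS.

(* The matrix, acting on column vectors, of w |-> v /\ w in a basis b of
   extpow p and a basis b' of extpow p.+1. *)
Definition wedge_mx (D D' : nat) (b : D.-tuple extalg) (b' : D'.-tuple extalg)
    (v : 'rV[K]_m) : 'M[K]_(D', D) :=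
  \matrix_(i, j) coord b' i (wedge (ext_vec v) (tnth b j)).

End Exterior.

Section Tensors.
Variables (K : fieldType) (m : nat).

Definition tensor3 := {ffun 'I_m * 'I_m * 'I_m -> K^o}.

Definition pure_tensor (a b c : 'rV[K]_m) : tensor3 :=
  [ffun t => a 0 t.1.1 * b 0 t.1.2 * c 0 t.2].

(* s (x) X, with E_(j,k) standing for e_j (x) e_k. *)
Definition vec_mx_tensor (s : 'rV[K]_m) (X : 'M[K]_m) : tensor3 :=
  [ffun t => s 0 t.1.1 * X t.1.2 t.2].

Definition sum_of_pure (n : nat) (T : tensor3) : Prop :=
  exists a b c : 'I_n -> 'rV[K]_m, T = \sum_i pure_tensor (a i) (b i) (c i).

Definition smallest (P : nat -> Prop) (n : nat) : Prop :=
  P n /\ forall k, P k -> (n <= k)%N.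

Definition tensor_rank (T : tensor3) (r : nat) : Prop :=
  smallest (fun n => sum_of_pure n T) r.

Definition rank_le (n : nat) (T : tensor3) : Prop :=
  exists2 r, tensor_rank T r & (r <= n)%N.

Definition ncoord := #|{: 'I_m * 'I_m * 'I_m}|.

Definition coords (T : tensor3) : 'I_ncoord -> K := fun k => T (enum_val k).

Definition zariski_closure (Z : tensor3 -> Prop) (T : tensor3) : Prop :=
  forall f : {mpoly K[ncoord]},
    (forall S, Z S -> f.@[coords S] = 0) -> f.@[coords T] = 0.

Definition border_rank (T : tensor3) (r : nat) : Prop :=
  smallest (fun n => zariski_closure (rank_le n) T) r.

Definition border_rank_le (n : nat) (T : tensor3) : Prop :=
  exists2 r, border_rank T r & (r <= n)%N.

Definition tensor_delta (t : 'I_m * 'I_m * 'I_m) : tensor3 :=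
  [ffun t' => (t' == t)%:R].

(* The matrix of linear forms of a linear map phi from tensors to matrices:
   its value at the tensor with indeterminate coordinates. Over a finite field
   this is what distinguishes a minor as a polynomial from the function that
   it induces. *)
Definition generic_mx (M : nat) (phi : tensor3 -> 'M[K]_M) :
    'M[{mpoly K[ncoord]}]_M :=
  \matrix_(i, j) \sum_t phi (tensor_delta t) i j *: 'X_(enum_rank t).

(* Any tensor T is the sum over i of e_i (x) X_i, where X_i j k = T (i, j, k). *)
Definition phi_map (D : nat) (L : 'rV[K]_m -> 'M[K]_D) (T : tensor3) :
    'M[K]_(D * m) :=
  \sum_i tensmx (L (delta_mx 0 i)) (\matrix_(j, k) (T (i, j, k) : K)).

End Tensors.

Definition increasing (N M : nat) (f : 'I_N -> 'I_M) : Prop :=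
  {homo f : i j / (i < j)%N}.

Definition minor (R : comNzRingType) (M N : nat) (f g : 'I_N -> 'I_M)
    (A : 'M[R]_M) : R :=
  \det (mxsub f g A).

Section Facts.
Variables (K : fieldType) (m : nat).
Local Notation E := (extalg K m).
Local Notation eb := (@ebase K m).

Lemma extalg_sum (u : E) : u = \sum_A u A *: eb A.
Proof.
apply/ffunP=> B; rewrite sum_ffunE (bigD1 B) //= big1 ?addr0.
  by rewrite !ffunE eqxx /GRing.scale /= mulr1.
by move=> A nAB; rewrite !ffunE eq_sym (negbTE nAB) /GRing.scale /= mulr0.
Qed.

Lemma wedge_is_linear_l (w : E) : linear (fun u => wedge u w).
Proof.
move=> a u v; apply/ffunP=> A; rewrite !ffunE scaler_sumr -big_split /=.
apply: eq_bigr => S _; rewrite !ffunE /GRing.scale /=.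
by rewrite mulrDr mulrDl mulrCA -!mulrA.
Qed.

Lemma wedge_is_linear_r (u : E) : linear (wedge u).
Proof.
move=> a v w; apply/ffunP=> A; rewrite !ffunE scaler_sumr -big_split /=.
apply: eq_bigr => S _; rewrite !ffunE /GRing.scale /=.
by rewrite mulrDr mulrCA.
Qed.

Lemma wedge_ebase (S T : {set 'I_m}) : wedge (eb S) (eb T) =
  if [disjoint S & T] then (-1) ^+ inversions S T *: eb (S :|: T) else 0.
Proof.
apply/ffunP=> A; rewrite ffunE.
have [sSA|nsSA] := boolP (S \subset A); last first.
  rewrite big1 => [|B]; last first.
    rewrite powersetE => sBA; rewrite !ffunE.
    by case: eqP sBA nsSA => [-> ->//|]; rewrite mulr0 mul0r.
  case: ifP => _; rewrite !ffunE //.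
  case: eqP nsSA => [->|_ _]; first by rewrite subsetUl.
  by rewrite /GRing.scale /= mulr0.
rewrite (bigD1 S) ?powersetE //= big1 ?addr0; last first.
  by move=> B /andP[_ nBS]; rewrite !ffunE (negbTE nBS) mulr0 mul0r.
rewrite !ffunE eqxx mulr1; case: eqP => [<-|nT].
  rewrite -setI_eq0 setDE setICA setICr setI0 eqxx -setDE.
  have ->: S :|: (A :\: S) = A by rewrite -{1}(setIidPr sSA) setID.
  by rewrite !ffunE eqxx.
rewrite mulr0; case: ifP => dST; rewrite !ffunE //.
case: eqP => [eA|]; last by rewrite /GRing.scale /= mulr0.
case: nT; rewrite eA setDUl setDv set0U; apply/setDidPl.
by rewrite disjoint_sym.
Qed.

Lemma wedge_vec_ebase (i : 'I_m) (S : {set 'I_m}) :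
  wedge (ext_vec (delta_mx 0 i)) (eb S) =
  if i \in S then 0
  else (-1) ^+ #|[set j in S | (j < i)%N]| *: eb (i |: S).
Proof.
have ->: ext_vec (delta_mx 0 i) = eb [set i].
  rewrite /ext_vec (bigD1 i) //= big1 ?addr0 => [|j nji].
    by rewrite mxE !eqxx scale1r.
  by rewrite mxE (negbTE nji) andbF scale0r.
rewrite wedge_ebase disjoints1; case: (i \in S) => //=.
congr (_ ^+ _ *: _); rewrite /inversions.
rewrite -(card_imset _ (_ : injective (fun j : 'I_m => (i, j)))); last first.
  by move=> j k [].
apply: eq_card => -[j k]; rewrite !inE /=; apply/and3P/imsetP.
  by case=> /eqP-> kS ki; exists k; rewrite ?inE ?kS.
by case=> l; rewrite inE => /andP[lS li] [-> ->].
Qed.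

Lemma ebase_free (s : seq {set 'I_m}) : uniq s -> free (map eb s).
Proof.
elim: s => [|A s IHs] /=; first by rewrite nil_free.
case/andP=> nAs us; rewrite free_cons IHs // andbT.
apply/negP => eA; have /ffunP/(_ A) := @coord_span _ _ _ (in_tuple (map eb s)) _ eA.
rewrite sum_ffunE big1 => [|i _].
  by rewrite !ffunE eqxx => /eqP; rewrite oner_eq0.
have ltis : (i < size s)%N by rewrite -(size_map eb s) ltn_ord.
rewrite ffunE /in_tuple /= (nth_map set0) // ffunE.
case: eqP => [eA'|_]; last by rewrite /GRing.scale /= mulr0.
by case/negP: nAs; rewrite eA' mem_nth.
Qed.

Lemma dim_extpow p : \dim (extpow K m p) = 'C(m, p).
Proof.
have /eqnP -> := ebase_free (enum_uniq [set A : {set 'I_m} | #|A| == p]).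
by rewrite size_map -cardE card_draws card_ord.
Qed.

Lemma wedge_extpow p (v : 'rV[K]_m) (w : E) :
  w \in extpow K m p -> wedge (ext_vec v) w \in extpow K m p.+1.
Proof.
have sumP q (s : seq E) (x : E) (f : {linear E -> E}) :
    x \in <<s>>%VS -> {in s, forall y, f y \in extpow K m q} ->
    f x \in extpow K m q.
  move=> xs fs; rewrite (@coord_span _ _ _ (in_tuple s) _ xs)  linear_sum memv_suml // => i _.
  by rewrite linearZ memvZ // fs // mem_nth.
pose fr := GRing.isLinear.Build _ _ _ _ _ (wedge_is_linear_r (ext_vec v)).
pose fR : {linear E -> E} := HB.pack (wedge (ext_vec v)) fr.
move=> wp; apply: (sumP _ _ _ fR wp) => _ /mapP[S + ->] /=.
rewrite mem_enum inE => /eqP cS.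
pose fl := GRing.isLinear.Build _ _ _ _ _ (wedge_is_linear_l (eb S)).
pose fL : {linear E -> E} := HB.pack (fun u => wedge u (eb S)) fl.
rewrite -[wedge _ _]/(fL (ext_vec v)) linear_sum memv_suml // => i _.
rewrite linearZ memvZ //= wedge_ebase disjoints1.
case: ifP => [iS|_]; last exact: mem0v.
rewrite memvZ // memv_span // map_f // mem_enum inE cardsU1.
by rewrite iS cS.
Qed.

Lemma wedge_mx_is_linear D D' (b : D.-tuple E) (b' : D'.-tuple E) :
  linear (wedge_mx b b').
Proof.
move=> a u v; apply/matrixP=> i j; rewrite !mxE.
have ->: ext_vec (a *: u + v) = a *: ext_vec u + ext_vec v.
  rewrite /ext_vec scaler_sumr -big_split; apply: eq_bigr => k _ /=.
  by rewrite !mxE scalerDl scalerA.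
by rewrite wedge_is_linear_l linearP.
Qed.

Lemma phi_map_is_linear D (L : 'rV[K]_m -> 'M[K]_D) : linear (phi_map L).
Proof.
move=> a T U; rewrite /phi_map scaler_sumr -big_split; apply: eq_bigr => i _.
by apply/matrixP=> j k; rewrite !mxE !ffunE mulrDr /GRing.scale /= mulrCA.
Qed.

Lemma phi_map_tensor D (L : {linear 'rV[K]_m -> 'M[K]_D}) s X :
  phi_map L (vec_mx_tensor s X) = tensmx (L s) X.
Proof.
rewrite {2}[s]row_sum_delta linear_sum; apply/matrixP=> j k.
rewrite /phi_map summxE !mxE summxE mulr_suml; apply: eq_bigr => i _.
by rewrite linearZ !mxE ffunE /= mulrCA mulrA.
Qed.

Lemma minor_generic_mx M N (phi : {linear tensor3 K m -> 'M[K]_M})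
    (f g : 'I_N -> 'I_M) (T : tensor3 K m) :
  (minor f g (generic_mx phi)).@[coords T] = minor f g (phi T).
Proof.
rewrite /minor -det_map_mx; congr (\det _); apply/matrixP=> i j.
have {2}->: T = \sum_t T t *: tensor_delta K t.
  apply/ffunP=> u; rewrite sum_ffunE (bigD1 u) //= big1 ?addr0.
    by rewrite !ffunE eqxx /GRing.scale /= mulr1.
  by move=> t ntu; rewrite !ffunE eq_sym (negbTE ntu) /GRing.scale /= mulr0.
rewrite !mxE linear_sum summxE raddf_sum; apply: eq_bigr => t _ /=.
by rewrite mevalZ mevalXU /coords enum_rankK linearZ !mxE mulrC.
Qed.

End Facts.

(* Main.v *)
From HB Require Import structures.
Require Import Defs.
From mathcomp Require Import all_boot all_order all_algebra.
From mathcomp Require Import mpoly mxtens zify.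
Import Order.TTheory GRing.Theory.
Local Open Scope ring_scope.

Set Implicit Arguments.
Unset Strict Implicit.
Unset Printing Implicit Defensive.

(** Vanishing.  For every vector v the map w |-> v /\ w on the p-th exterior
    power has rank at most C(2p, p): since v /\ v /\ w = 0, its image is already
    spanned by the v /\ e_S with S avoiding one fixed index in the support of v
    ([rank_wedge_mx]).  The flattening of a pure tensor a (x) b (x) c is the
    Kronecker product of the matrix of a /\ with a matrix of rank at most 1, so
    the flattening of a tensor of rank at most n has rank at most n C(2p, p).
    With n = 2m - 4 this is less than N, so the N x N minors vanish on tensors of
    rank at most n, and, being polynomials, on the Zariski closure.

    Nonvanishing.  It is enough to find, over some extension field F of K, a
    tensor whose flattening has rank at least N: its coordinates are then a point
    where some minor is nonzero.  Taking F = K(t) provides m distinct points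
    x_i = t^i.  Fix an index i0.  The tensor used is the sum of the e_i (x) X_i,
    where X_i is block diagonal, with blocks
      - the Hankel matrix (x_i^(j+k)) of size p + 1, for every i;
      - the Hankel matrix (x_i^(j+k)) of size p, for i <> i0, and 0 for i = i0.
    A kernel vector of the flattening of the first block is a family of
    polynomials beta_S of degree at most p, where |S| = p, such that for every U
    of size p + 1 the sum over i in U of +- beta_(U - i)(x_i) (x_i^j)_j vanishes.
    The p + 1 vectors (x_i^j)_j, i in U, are independent (Vandermonde), so
    beta_S(x_i) = 0 for all i outside S; these are p + 1 points, so beta_S = 0.
    So this flattening is injective.  The flattening of the second block splits
    according to whether the sets S and U contain i0 or not.  If they do, only p
    points of U are left to use, and the same argument shows injectivity.
    If they do not, then only p points are left outside S, and the same argument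
    applied to the transpose shows surjectivity.  The total rank is
      (p + 1) C(2p+1, p) + p C(2p, p-1) + p C(2p, p+1),
    and it is at least N ([koszul_rank_arith]).

    The argument common to the three cases is [koszul_kernel_eq0]; the three
    cases are put together by [rank_ge_cols_add_rows]. *)

(** * Ranks and minors *)

Lemma rank_lt_minor_eq0 (F : fieldType) M N (f g : 'I_N -> 'I_M) (A : 'M[F]_M) :
  (\rank A < N)%N -> minor f g A = 0.
Proof.
move=> ltAN; apply/eqP; rewrite -[_ == 0]negbK -unitfE -unitmxE -row_free_unit.
apply/negP => /eqP rN; move: ltAN; rewrite -rN ltnNge => /negP; apply.
rewrite mxsubrc; apply: leq_trans (mxrankS (rowsub_sub _ _)) _.
rewrite -mxrank_tr trmx_mxsub -(mxrank_tr A).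
exact: mxrankS (rowsub_sub _ _).
Qed.

(** Rows chosen by Gaussian elimination come in no particular order; listing the
    same set of rows in increasing order does not change their span. *)
Lemma exists_increasing_row_free (F : fieldType) m n N (A : 'M[F]_(m, n)) :
  (N <= \rank A)%N ->
  exists2 f : 'I_N -> 'I_m, increasing f & row_free (rowsub f A).
Proof.
move=> leNA.
pose h := maxrankfun A \o widen_ord leNA.
have hI : injective h.
  by move=> i j /maxrankfun_inj/(congr1 val)/= /val_inj.
have rh : row_free (rowsub h A).
  apply: inj_row_free => v vh.
  have := maxrowsub_free A => /row_freeP[B AB].
  have eh : rowsub h A = rowsub (widen_ord leNA) (rowsub (maxrankfun A) A).
    by rewrite -rowsub_comp.
  have : v *m (rowsub h A *m B) = 0 by rewrite mulmxA vh mul0mx.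
  rewrite eh mul_rowsub_mx AB => v0; apply/rowP => i.
  have /rowP/(_ (widen_ord leNA i)) := v0.
  rewrite !mxE (bigD1 i) //= big1 => [|j nj]; last first.
    by rewrite !mxE -val_eqE /= val_eqE (negbTE nj) mulr0.
  by rewrite !mxE eqxx mulr1 addr0.
pose H := [set h i | i : 'I_N].
have cH : #|H| = N by rewrite card_imset // card_ord.
pose f : 'I_N -> 'I_m := Order.enum_val (A := H) \o cast_ord (esym cH).
exists f => [i j ltij|].
  rewrite ltnNge; have -> : (f j <= f i)%N = (j <= i)%N.
    exact: (Order.le_enum_val le_total (cast_ord (esym cH) j)
                                       (cast_ord (esym cH) i)).
  by rewrite -ltnNge.
have hH i : h i \in H by apply: imset_f.
have gE i : h i = f (cast_ord cH (Order.enum_rank_in (hH i) (h i))).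
  by rewrite /f /= cast_ordK Order.enum_rankK_in.
rewrite /row_free eqn_leq rank_leq_row -{1}(eqP rh).
exact: mxrankS (submx_rowsub _ gE).
Qed.

Lemma exists_increasing_minor_neq0 (F : fieldType) M N (A : 'M[F]_M) :
  (N <= \rank A)%N -> exists f g : 'I_N -> 'I_M,
    [/\ increasing f, increasing g & minor f g A != 0].
Proof.
case/exists_increasing_row_free => f incf /eqP rf.
have [|g incg /eqP rg] := @exists_increasing_row_free F _ _ N (rowsub f A)^T.
  by rewrite mxrank_tr rf.
exists f, g; split=> //.
rewrite /minor -unitfE -unitmxE -row_free_unit /row_free.
by rewrite mxsubcr -mxrank_tr trmx_mxsub rg.
Qed.

(** The space spanned by the columns in X lies in the kernel of the projection to
    the coordinates in Y, while this projection maps the whole column space onto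
    a space of dimension #|Y|; rank-nullity gives the bound. *)
Lemma rank_ge_cols_add_rows (F : fieldType) n1 n2 (A : 'M[F]_(n1, n2))
    (X : {set 'I_n2}) (Y : {set 'I_n1}) :
  (forall v : 'cV_n2, (forall x, x \notin X -> v x 0 = 0) ->
     A *m v = 0 -> v = 0) ->
  (forall w : 'cV_n1, (forall y, y \notin Y -> w y 0 = 0) ->
     A^T *m w = 0 -> w = 0) ->
  (forall x y, x \in X -> y \in Y -> A y x = 0) ->
  (#|X| + #|Y| <= \rank A)%N.
Proof.
move=> injX injY A0.
pose sX : 'M[F]_(#|X|, n2) := rowsub enum_val 1%:M.
pose sY : 'M[F]_(#|Y|, n1) := rowsub enum_val 1%:M.
have sub0 k l (B : {set 'I_k}) (u : 'M[F]_(l, #|B|)) i x : x \notin B ->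
    (u *m rowsub enum_val 1%:M : 'M_(l, k)) i x = 0.
  move=> nBx; rewrite mxE big1 // => j _; rewrite !mxE.
  by case: eqP (enum_valP j) nBx => [->->|]; rewrite ?mulr0.
have subI k l (B : {set 'I_k}) (u : 'M[F]_(l, #|B|)) :
    u *m rowsub enum_val 1%:M = 0 :> 'M_(l, k) -> u = 0.
  move=> u0; apply/matrixP=> i j; have /matrixP/(_ i (enum_val j)) := u0.
  rewrite mxE (bigD1 j) //= big1 => [|j' nj]; last first.
    by rewrite !mxE (inj_eq enum_val_inj) (negbTE nj) mulr0.
  by rewrite !mxE eqxx mulr1 addr0.
have rX : row_free (sX *m A^T).
  apply: inj_row_free => v; rewrite mulmxA => vA; apply: (subI _ _ _ v).
  apply: trmx_inj; rewrite trmx0; apply: injX => [x nXx|].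
    by rewrite mxE sub0.
  by apply: trmx_inj; rewrite trmx_mul trmxK vA trmx0.
have rY : row_free (sY *m A).
  apply: inj_row_free => v; rewrite mulmxA => vA; apply: (subI _ _ _ v).
  apply: trmx_inj; rewrite trmx0; apply: injY => [y nYy|].
    by rewrite mxE sub0.
  by apply: trmx_inj; rewrite trmx_mul !trmxK vA trmx0.
rewrite -mxrank_tr -(mxrank_mul_ker _ sY^T) addnC; apply: leq_add.
  by rewrite -trmx_mul mxrank_tr (eqP rY).
rewrite -(eqP rX) mxrankS // sub_capmx submxMl /=; apply/sub_kermxP.
rewrite -mulmxA -trmx_mul; apply/matrixP => i j.
rewrite -rowsubE !mxE.
rewrite (bigD1 (enum_val j)) //= big1 ?addr0 => [|y ny].
  by rewrite !mxE eqxx mul1r A0 ?enum_valP.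
by rewrite !mxE eq_sym (negbTE ny) mul0r.
Qed.

(** * Multiplication by a vector in the exterior algebra *)

Section ExteriorMultiplication.
Variables (K : fieldType) (m : nat).
Local Notation E := (extalg K m).
Local Notation eb := (@ebase K m).
Local Notation ev i := (ext_vec (delta_mx 0 i : 'rV[K]_m)).

HB.instance Definition _ (u : E) :=
  GRing.isLinear.Build K E E *:%R (wedge u) (wedge_is_linear_r u).

HB.instance Definition _ D D' (b : D.-tuple E) (b' : D'.-tuple E) :=
  GRing.isLinear.Build K 'rV[K]_m 'M[K]_(D', D) *:%R (wedge_mx b b')
    (wedge_mx_is_linear b b').

Lemma wedge_ext_vecE (v : 'rV[K]_m) (w : E) :
  wedge (ext_vec v) w = \sum_i v 0 i *: wedge (ev i) w.
Proof.
pose f u := wedge (ext_vec u) w.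
have f_lin : linear f.
  move=> a u u'; rewrite /f.
  have -> : ext_vec (a *: u + u') = a *: ext_vec u + ext_vec u'.
    rewrite /ext_vec scaler_sumr -big_split; apply: eq_bigr => k _ /=.
    by rewrite !mxE scalerDl scalerA.
  exact: wedge_is_linear_l.
pose fB := GRing.isLinear.Build _ _ _ _ _ f_lin.
pose fL : {linear 'rV[K]_m -> E} := HB.pack f fB.
rewrite -[LHS]/(fL v) [v in LHS]row_sum_delta linear_sum.
by apply: eq_bigr => i _; rewrite linearZ.
Qed.

Lemma wedge_vec_ebase_anti (i j : 'I_m) (A : {set 'I_m}) : i != j ->
  wedge (ev i) (wedge (ev j) (eb A)) = - wedge (ev j) (wedge (ev i) (eb A)).
Proof.
have count k l : k != l ->
    #|[set x in k |: A | (x < l)%N]| =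
    ((k < l)%N && (k \notin A) + #|[set x in A | (x < l)%N]|)%N.
  move=> nkl; have [ltkl|lelk] := ltnP k l => /=.
    have -> : [set x in k |: A | (x < l)%N] = k |: [set x in A | (x < l)%N].
      by apply/setP=> x; rewrite !inE; case: eqP => [->|]; rewrite ?ltkl.
    by rewrite cardsU1 inE ltkl andbT.
  apply: eq_card => x; rewrite !inE; case: eqP => [->|] //=.
  by rewrite ltnNge lelk /= andbF.
move=> nij; rewrite !wedge_vec_ebase.
have [iA|niA] := boolP (i \in A); have [jA|njA] := boolP (j \in A);
  rewrite ?linear0 ?oppr0 // ?linearZ /= ?wedge_vec_ebase ?inE ?iA ?jA ?orbT
    ?scaler0 ?oppr0 ?scaler0 //.
rewrite [j == i]eq_sym (negbTE nij) (negbTE niA) (negbTE njA) /=.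
rewrite scalerN !scalerA -!exprD -scaleNr setUCA !count 1?[j == i]eq_sym //.
rewrite niA njA !andbT; congr (_ *: _); rewrite addnCA !exprD.
rewrite [(-1) ^+ #|[set x in A | (x < i)%N]| * _]mulrC !mulrA -!mulNr.
(* Exactly one of i < j and j < i holds, which gives the opposite signs. *)
congr (_ * _ * _); case: ltngtP nij => [| |/val_inj ->];
  by rewrite ?expr0 ?expr1 ?opprK ?mulN1r ?mul1r ?eqxx.
Qed.

(** The product is bilinear in the two copies of v, and the terms e_i /\ e_j and
    e_j /\ e_i cancel.  Pairing them, instead of deducing 2 v /\ v = 0, makes the
    argument valid in characteristic 2. *)
Lemma wedge_ext_vec_sqr (v : 'rV[K]_m) (w : E) :
  wedge (ext_vec v) (wedge (ext_vec v) w) = 0.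
Proof.
rewrite [w]extalg_sum !linear_sum big1 //= => A _; rewrite !linearZ /=.
rewrite wedge_ext_vecE; set t := \sum_i _; suff -> : t = 0 by rewrite scaler0.
pose s i j := (v 0 i * v 0 j) *: wedge (ev i) (wedge (ev j) (eb A)).
have -> : t = \sum_i \sum_j s i j.
  apply: eq_bigr => i _; rewrite (wedge_ext_vecE v) linear_sum scaler_sumr.
  by apply: eq_bigr => j _; rewrite linearZ scalerA.
have s_diag i : s i i = 0.
  rewrite /s wedge_vec_ebase; case: ifP => [_|niA].
    by rewrite linear0 scaler0.
  by rewrite linearZ /= wedge_vec_ebase setU11 !scaler0.
have s_anti i j : i != j -> s i j = - s j i.
  by move=> nij; rewrite /s wedge_vec_ebase_anti // scalerN mulrC.
have split i : \sum_j s i j =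
    \sum_(j : 'I_m | (j < i)%N) s i j - \sum_(j : 'I_m | (i < j)%N) s j i.
  rewrite (bigID (fun j : 'I_m => (j < i)%N)) /= -sumrN; congr (_ + _).
  rewrite (bigD1 i) ?ltnn //= s_diag add0r; apply: eq_big => j.
    by rewrite -leqNgt [in RHS]ltn_neqAle eq_sym andbC.
  by case/andP => _ nji; apply: s_anti; rewrite eq_sym.
rewrite (eq_bigr _ (fun i _ => split i)) big_split /= sumrN.
by rewrite (exchange_big_dep predT) //= subrr.
Qed.

Lemma exists_subset_tuple q D : D = 'C(m, q) ->
  exists2 s : D.-tuple {set 'I_m}, uniq s & forall A, (A \in s) = (#|A| == q).
Proof.
move=> eD; pose T := [set A : {set 'I_m} | #|A| == q].
have szT : size (enum T) == D by rewrite -cardE card_draws card_ord eD.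
by exists (Tuple szT) => [|A]; rewrite ?enum_uniq // mem_enum inE.
Qed.

Lemma subset_tuple_tnth q D (T : D.-tuple {set 'I_m}) (A : {set 'I_m}) :
  (forall B, (B \in T) = (#|B| == q)) -> #|A| = q -> exists i, tnth T i = A.
Proof. by move=> TE /eqP; rewrite -TE => /tnthP[i ->]; exists i. Qed.

Lemma card_tuple_notin q D (T : D.-tuple {set 'I_m}) (i0 : 'I_m) :
  uniq T -> (forall A, (A \in T) = (#|A| == q)) ->
  #|[set a | i0 \notin tnth T a]| = 'C(m.-1, q).
Proof.
move=> uT TE.
have <- : #|[set B : {set 'I_m} | B \subset [set~ i0] & #|B| == q]| = 'C(m.-1, q).
  by rewrite cards_draws cardsC1 card_ord.
rewrite -(card_imset _ (tuple_uniqP _ uT)); apply: eq_card => B; rewrite !inE.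
rewrite -TE subsetC sub1set inE.
apply/imsetP/andP => [[a ai0 ->]|[Bi0 /tnthP[a eB]]].
  by rewrite mem_tnth; split=> //; rewrite inE in ai0.
by exists a; rewrite // inE -eB.
Qed.

Lemma mem_extpow_span q (w : E) (s : seq {set 'I_m}) :
   (forall A, (A \in s) = (#|A| == q)) -> w \in extpow K m q ->
   w \in <<map eb s>>%VS.
Proof.
move=> sE; apply: subvP; apply: sub_span => _ /mapP[A + ->].
by rewrite mem_enum inE -sE => sA; apply: map_f.
Qed.

Lemma ebase_basis q D (s : D.-tuple {set 'I_m}) :
  uniq s -> (forall A, (A \in s) = (#|A| == q)) ->
  basis_of (extpow K m q) (map_tuple eb s).
Proof.
move=> us sE; rewrite basisEfree ebase_free //=; apply/andP; split.
  apply: sub_span => _ /mapP[A sA ->]; apply: map_f.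
  by rewrite mem_enum inE -sE.
rewrite dim_extpow size_map -(card_uniqP us).
have <- : #|[set A : {set 'I_m} | #|A| == q]| = 'C(m, q).
  by rewrite card_draws card_ord.
by apply/eq_leq/eq_card => A; rewrite inE sE.
Qed.

Lemma coord_ebase q D (s : D.-tuple {set 'I_m}) i (w : E) :
  uniq s -> (forall A, (A \in s) = (#|A| == q)) -> w \in extpow K m q ->
  coord (map_tuple eb s) i w = w (tnth s i).
Proof.
move=> us sE /(mem_extpow_span sE) ws.
rewrite [in RHS](coord_span (X := map_tuple eb s) ws).
rewrite sum_ffunE (bigD1 i) //= big1 ?addr0 => [|j nji].
  by rewrite ffunE -tnth_nth tnth_map ffunE eqxx /GRing.scale /= mulr1.
rewrite ffunE -tnth_nth tnth_map ffunE (inj_eq (tuple_uniqP _ us)) eq_sym.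
by rewrite (negbTE nji) /GRing.scale /= mulr0.
Qed.

(** The bases in the theorem are arbitrary; this reduces rank computations to the
    bases of monomials e_S, in both directions since either pair of bases can be
    the given one. *)
Lemma wedge_mx_change q D1 D2 D1' D2' (b1 : D1.-tuple E) (b2 : D2.-tuple E)
    (b1' : D1'.-tuple E) (b2' : D2'.-tuple E) :
  basis_of (extpow K m q) b1 -> basis_of (extpow K m q) b2 ->
  basis_of (extpow K m q.+1) b1' ->
  exists (P : 'M[K]_(D2', D1')) (Q : 'M[K]_(D1, D2)), forall v,
    wedge_mx b2 b2' v = P *m wedge_mx b1 b1' v *m Q.
Proof.
move=> B1 B2 B1'.
exists (\matrix_(i, j) coord b2' i (tnth b1' j)).
exists (\matrix_(i, j) coord b1 i (tnth b2 j)) => v.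
apply/matrixP => i j; rewrite !mxE.
have b2P : tnth b2 j \in extpow K m q by rewrite (basis_mem B2) ?mem_tnth.
rewrite [in LHS](coord_basis B1 b2P) linear_sum linear_sum.
apply: eq_bigr => k _; rewrite !linearZ /= !mxE mulrC; congr (_ * _).
have b1P : wedge (ext_vec v) b1`_k \in extpow K m q.+1.
  by rewrite wedge_extpow // (basis_mem B1) // -tnth_nth mem_tnth.
rewrite (coord_basis B1' b1P) linear_sum; apply: eq_bigr => l _.
by rewrite linearZ /= !mxE mulrC !(tnth_nth 0).
Qed.

(** Let i0 be in the support of v.  For S containing i0, expanding
    v /\ (v /\ e_(S - i0)) = 0 expresses v /\ e_S through the v /\ e_T with T
    avoiding i0, and there are C(m - 1, q) such T. *)
Lemma rank_wedge_mx q D D' (b : D.-tuple E) (b' : D'.-tuple E) v :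
  basis_of (extpow K m q) b -> basis_of (extpow K m q.+1) b' ->
  (\rank (wedge_mx b b' v) <= 'C(m.-1, q))%N.
Proof.
move=> Bb Bb'.
have [->|/rV0Pn[i0 vi0]] := eqVneq v 0; first by rewrite linear0 mxrank0.
have [s us sE] := exists_subset_tuple (erefl 'C(m, q)).
have sB := ebase_basis us sE.
have [P [Q ->]] := wedge_mx_change b' sB Bb Bb'.
apply: leq_trans (mxrankM_maxl _ _) _; apply: leq_trans (mxrankM_maxr _ _) _.
pose r (w : E) : 'rV[K]_D' := \row_i coord b' i (wedge (ext_vec v) w).
have r_lin : linear r.
  by move=> a u w; apply/rowP => i; rewrite !mxE !linearP.
pose rB := GRing.isLinear.Build _ _ _ _ _ r_lin.
pose rL : {linear E -> 'rV[K]_D'} := HB.pack r rB.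
pose T := [set A : {set 'I_m} | A \subset ~: [set i0] & #|A| == q].
pose R := \matrix_(i < #|T|) r (eb (enum_val i)).
have cT : #|T| = 'C(m.-1, q).
  rewrite cards_draws; congr 'C(_, _); rewrite cardsC1.
  by rewrite card_ord.
rewrite -mxrank_tr -cT; apply: leq_trans (rank_leq_row R); apply: mxrankS.
have TR (A : {set 'I_m}) : #|A| = q -> i0 \notin A -> (r (eb A) <= R)%MS.
  move=> cA ni0.
  have AT : A \in T by rewrite inE cA eqxx andbT subsetC sub1set inE.
  apply: (eq_row_sub (enum_rank_in AT A)).
  by rewrite rowK enum_rankK_in.
apply/row_subP => j; set A := tnth s j.
have cA : #|A| = q by apply/eqP; rewrite -sE mem_tnth.
have -> : row j (wedge_mx (map_tuple eb s) b' v)^T = r (eb A).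
  by apply/rowP => i; rewrite !mxE tnth_map.
have [i0A|] := boolP (i0 \in A); last exact: TR.
(* The term i = i0 of the expansion is a nonzero multiple of v /\ e_A. *)
have := wedge_ext_vec_sqr v (eb (A :\ i0)).
rewrite [wedge (ext_vec v) (eb _)]wedge_ext_vecE => rel.
have {}rel : \sum_i v 0 i *: rL (wedge (ev i) (eb (A :\ i0))) = 0.
  rewrite -[RHS](_ : rL (\sum_i v 0 i *: wedge (ev i) (eb (A :\ i0))) = 0).
    by rewrite linear_sum; apply: eq_bigr => i _; rewrite linearZ.
  by apply/rowP => i; rewrite !mxE rel linear0.
move: rel; rewrite (bigD1 i0) //= => /eqP; rewrite addr_eq0 => /eqP.
rewrite wedge_vec_ebase !inE eqxx /= setD1K //.
rewrite -[r (_ *: _)]/(rL _) linearZ /= scalerA => rel.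
set c := v 0 i0 * _ in rel.
have c0 : c != 0 by rewrite mulf_neq0 // signr_eq0.
rewrite -[r _](scalerK c0) [c *: _]rel scalemx_sub // eqmx_opp.
apply: summx_sub => i nii0; apply: scalemx_sub.
rewrite wedge_vec_ebase; case: ifPn => [_|niA].
  by rewrite -[r _]/(rL _) linear0 sub0mx.
rewrite -[r _]/(rL _) linearZ /= scalemx_sub // TR //; last first.
  by rewrite !inE eq_sym (negbTE nii0) eqxx.
by rewrite cardsU1 niA -cA [in RHS](cardsD1 i0) i0A.
Qed.

Lemma wedge_mx_ebaseE q D D' (s : D.-tuple {set 'I_m})
    (s' : D'.-tuple {set 'I_m}) (i : 'I_m) u j :
  (forall A, (A \in s) = (#|A| == q)) ->
  uniq s' -> (forall A, (A \in s') = (#|A| == q.+1)) ->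
  wedge_mx (map_tuple eb s) (map_tuple eb s') (delta_mx 0 i) u j =
  if (i \notin tnth s j) && (tnth s' u == i |: tnth s j)
  then (-1) ^+ #|[set k in tnth s j | (k < i)%N]| else 0.
Proof.
move=> sE us' s'E; rewrite mxE tnth_map (coord_ebase _ us' s'E); last first.
  apply: wedge_extpow; apply: memv_span; apply: map_f.
  by rewrite mem_enum inE -sE mem_tnth.
rewrite wedge_vec_ebase; case: ifP => /= niS; first by rewrite ffunE.
by rewrite !ffunE /GRing.scale /=; case: eqP; rewrite ?mulr1 ?mulr0.
Qed.

End ExteriorMultiplication.

(** * Vandermonde arguments *)

Section Vandermonde.
Variables (F : fieldType) (I : finType) (x : I -> F).
Hypothesis x_inj : injective x.

(** Row form of the invertibility of Vandermonde matrices.  The exponents are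
    read off from a part of a larger index type, as the blocks of a matrix need. *)
Lemma sparse_poly_coef_eq0 (J : finType) (P : pred J) (e : J -> nat) q
    (A : {set I}) (v : J -> F) :
  {in P &, injective e} -> (forall k, P k -> (e k < q)%N) -> (q <= #|A|)%N ->
  (forall i, i \in A -> \sum_(k | P k) v k * x i ^+ e k = 0) ->
  forall k, P k -> v k = 0.
Proof.
move=> e_inj e_lt qA vx k Pk.
pose f : {poly F} := \sum_(k | P k) v k *: 'X^(e k).
have fk : f`_(e k) = v k.
  rewrite coef_sum (bigD1 k) //= coefZ coefXn eqxx mulr1 big1 ?addr0 // => j.
  case/andP=> Pj njk; rewrite coefZ coefXn.
  case: eqP => [ekj|]; last by rewrite mulr0.
  by case/eqP: njk; apply/esym/e_inj.
rewrite -fk; suff -> : f = 0 by rewrite coef0.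
apply: contraTeq qA => f0; rewrite -ltnNge.
have szf : (size f <= q)%N.
  apply: (leq_trans (size_sum _ _ _)); apply/bigmax_leqP => j Pj.
  by apply: leq_trans (size_scale_leq _ _) _; rewrite size_polyXn e_lt.
apply: leq_trans szf; rewrite cardE -(size_map x).
apply: max_poly_roots => //; last by rewrite map_inj_uniq ?enum_uniq.
apply/allP=> _ /mapP[i + ->]; rewrite mem_enum => /vx vi.
rewrite rootE horner_sum -[X in _ == X]vi; apply/eqP; apply: eq_bigr => j _.
by rewrite hornerZ hornerXn.
Qed.

(** Column form of the invertibility of Vandermonde matrices: the hypothesis
    extends to all polynomials of degree less than q, in particular to the one
    vanishing at all points of A but one. *)
Lemma power_sums_eq0 q (A : {set I}) (w : I -> F) : (#|A| <= q)%N ->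
  (forall k, (k < q)%N -> \sum_(i in A) x i ^+ k * w i = 0) ->
  forall i, i \in A -> w i = 0.
Proof.
move=> Aq wx i iA.
have wf (f : {poly F}) : (size f <= q)%N -> \sum_(j in A) f.[x j] * w j = 0.
  move=> szf; under eq_bigr do rewrite (horner_coef_wide _ szf) mulr_suml.
  rewrite exchange_big big1 //= => k _.
  under eq_bigr do rewrite -mulrA.
  by rewrite -mulr_sumr wx ?mulr0.
pose f := \prod_(j in A :\ i) ('X - (x j)%:P).
have szf : size f = #|A|.
  by rewrite /f -big_enum size_prod_XsubC -cardE [RHS](cardsD1 i) iA.
have := wf f; rewrite szf => /(_ Aq); rewrite (bigD1 i) //= big1 ?addr0.
  move/eqP; rewrite mulf_eq0 => /orP[|/eqP//].
  rewrite horner_prod => /prodf_eq0[j]; rewrite !inE => /andP[nji _].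
  by rewrite hornerXsubC subr_eq0 (inj_eq x_inj) eq_sym (negbTE nji).
move=> j /andP[jA nji]; rewrite /f horner_prod (bigD1 j) ?inE ?nji //=.
by rewrite hornerXsubC subrr !mul0r.
Qed.

(** The family A i is an incidence structure: in the applications A i u s is a
    sign if the set U indexed by u is obtained from the set S indexed by s by
    adding i, or conversely, and 0 otherwise.  The vector v s holds the
    coefficients of a polynomial beta_s.  If u meets at most q of the points
    in I0, then the hypothesis on sums and [power_sums_eq0] show that
    beta_s(x_i) = 0 whenever A i u s <> 0.  So if s meets at least q points
    through such u, then beta_s has at least q roots but degree less than
    q. *)
Lemma koszul_kernel_eq0 (a b : finType) (A : I -> a -> b -> F) (I0 : {set I})
    (small : pred a) (J : finType) (P : pred J) (e : J -> nat) q
    (v : b -> J -> F) (s : b) :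
  {in P &, injective e} -> (forall k, P k -> (e k < q)%N) ->
  (forall i u s s', A i u s != 0 -> A i u s' != 0 -> s = s') ->
  (forall u, small u -> (#|[set i in I0 | [exists s, A i u s != 0%R]]| <= q)%N) ->
  (q <= #|[set i in I0 | [exists u, small u && (A i u s != 0%R)]]|)%N ->
  (forall u k, small u -> (k < q)%N ->
    \sum_(i in I0) x i ^+ k *
      (\sum_s A i u s * (\sum_(j | P j) v s j * x i ^+ e j)) = 0) ->
  forall j, P j -> v s j = 0.
Proof.
move=> e_inj e_lt A_inj A_small s_large sum0.
apply: (sparse_poly_coef_eq0 e_inj e_lt s_large) => i; rewrite inE.
case/andP=> iI0 /existsP[u /andP[u_small Aius]].
pose w i' := \sum_s A i' u s * (\sum_(j | P j) v s j * x i' ^+ e j).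
have w0 : w i = 0.
  apply: (power_sums_eq0 (A_small u u_small)) => [k ltkq|]; last first.
    by rewrite inE iI0; apply/existsP; exists s.
  rewrite -[RHS](sum0 u k u_small ltkq).
  rewrite [RHS](bigID (fun i' => [exists s, A i' u s != 0])) /=.
  rewrite [X in _ = _ + X]big1 ?addr0 => [|i' /andP[_]].
    by apply: eq_bigl => i'; rewrite inE.
  rewrite negb_exists => /forallP nA; rewrite big1 ?mulr0 // => s' _.
  by have /negPn/eqP-> := nA s'; rewrite mul0r.
move: w0; rewrite /w (bigD1 s) //= [X in _ + X]big1 ?addr0 => [|s' ns].
  by move/eqP; rewrite mulf_eq0 (negbTE Aius) => /eqP.
have [->|nz] := eqVneq (A i u s') 0; first by rewrite mul0r.
by rewrite (A_inj _ _ _ _ nz Aius) eqxx in ns.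
Qed.

End Vandermonde.

(** * Kronecker products *)

Lemma sum_tensmx_mulE (F : fieldType) (I : finType) D D' n n'
    (A : I -> 'M[F]_(D, D')) (X : I -> 'M[F]_(n, n')) (v : 'cV_(D' * n')) u j :
  ((\sum_i tensmx (A i) (X i)) *m v) (mxtens_index (u, j)) 0 =
  \sum_i \sum_s A i u s * \sum_k X i j k * v (mxtens_index (s, k)) 0.
Proof.
rewrite mulmx_suml summxE; apply: eq_bigr => i _; rewrite mxE.
have bij : bijective (@mxtens_index D' n').
  exists (@mxtens_unindex D' n'); first exact: mxtens_indexK.
  exact: mxtens_unindexK.
rewrite (reindex _ (onW_bij _ bij)) /=.
under [RHS]eq_bigr do rewrite mulr_sumr.
rewrite pair_bigA /=; apply: eq_bigr => -[s k] _ /=.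
by rewrite tensmxE mulrA.
Qed.

Lemma card_tens_index D n (P : pred ('I_D * 'I_n)) :
  #|[set c | P (@mxtens_unindex D n c)]| = #|[set ck | P ck]|.
Proof.
have inj : injective (@mxtens_index D n) by apply: can_inj (@mxtens_indexK D n).
rewrite -(card_imset _ inj); apply: eq_card => c; rewrite inE.
apply/idP/imsetP => [Pc|[ck]]; last first.
  by rewrite inE => Pck ->; rewrite mxtens_indexK.
by exists (mxtens_unindex c); rewrite ?mxtens_unindexK // inE.
Qed.

Lemma rank_tensmx_mul (F : fieldType) (a a' c c' : nat) (A : 'M[F]_(a, a'))
    (u : 'cV[F]_c) (w : 'rV[F]_c') :
  (\rank (tensmx A (u *m w)) <= \rank A)%N.
Proof.
rewrite -{1}(mulmx_base A) -tensmx_mul; apply: leq_trans (mulmx_max_rank _ _) _.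
by rewrite muln1.
Qed.

(** * Specialization of the generic minors over an extension field *)

Section Genericity.
Variables (K F : fieldType) (iota : {rmorphism K -> F}) (m D : nat).
Variables (L : 'rV[K]_m -> 'M[K]_D) (X : 'I_m -> 'M[F]_m).

Let slice_coords (k : 'I_(ncoord m)) : F :=
  X (enum_val k).1.1 (enum_val k).1.2 (enum_val k).2.

(** The right-hand side is the flattening of the tensor over F with slices X i,
    so a minor that is nonzero at this tensor is nonzero as a polynomial. *)
Lemma map_generic_mx :
  map_mx (mmap iota slice_coords) (generic_mx (phi_map L)) =
  \sum_i tensmx (map_mx iota (L (delta_mx 0 i))) (X i).
Proof.
apply/matrixP => r c; rewrite summxE !mxE raddf_sum /=.
pose u := mxtens_unindex r; pose w := mxtens_unindex c.
have term t : mmap iota slice_coords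
    (phi_map L (tensor_delta K t) r c *: 'X_(enum_rank t)) =
    iota (L (delta_mx 0 t.1.1) u.1 w.1) * ((t.1.2 == u.2) && (t.2 == w.2))%:R
      * X t.1.1 u.2 w.2.
  rewrite mmapZ mmapX mmap1U /slice_coords enum_rankK /phi_map summxE.
  rewrite (bigD1 t.1.1) //= big1 ?addr0 => [|i ni]; last first.
    rewrite !mxE ffunE; case: eqP => [eti|]; rewrite ?mulr0 //.
    by rewrite -eti eqxx in ni.
  rewrite !mxE ffunE rmorphM -!mulrA; congr (_ * _).
  case: t => [[i j] k] /=; rewrite !xpair_eqE eqxx /= eq_sym [w.2 == k]eq_sym.
  case: eqP => [<-|] /=; last by rewrite rmorph0 !mul0r.
  by case: eqP => [<-|] /=; rewrite ?rmorph1 ?rmorph0 ?mul0r.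
under eq_bigr do rewrite term.
rewrite (eq_bigr (fun t => (fun ij k => iota (L (delta_mx 0 ij.1) u.1 w.1) *
  ((ij.2 == u.2) && (k == w.2))%:R * X ij.1 u.2 w.2) t.1 t.2)) //.
rewrite -(pair_bigA _ (fun ij k => iota (L (delta_mx 0 ij.1) u.1 w.1) *
  ((ij.2 == u.2) && (k == w.2))%:R * X ij.1 u.2 w.2)) /=.
rewrite -(pair_bigA _ (fun i j => \sum_k iota (L (delta_mx 0 i) u.1 w.1) *
  ((j == u.2) && (k == w.2))%:R * X i u.2 w.2)) /=.
apply: eq_bigr => i _; rewrite !mxE (bigD1 u.2) //= (bigD1 w.2) //= !eqxx.
rewrite [X in _ + X + _]big1 => [|k nk]; last by rewrite (negbTE nk) mulr0 mul0r.
rewrite big1 => [|j nj]; last first.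
  by rewrite big1 // => k _; rewrite (negbTE nj) mulr0 mul0r.
by rewrite !addr0 mulr1.
Qed.

Lemma exists_generic_minor_neq0 N :
  (N <= \rank (\sum_i tensmx (map_mx iota (L (delta_mx 0 i))) (X i))%R)%N ->
  exists f g : 'I_N -> 'I_(D * m),
    [/\ increasing f, increasing g & minor f g (generic_mx (phi_map L)) != 0].
Proof.
case/exists_increasing_minor_neq0 => f [g [incf incg nz]].
exists f, g; split=> //; apply: contraNneq nz => gen0.
rewrite -map_generic_mx /minor -map_mxsub det_map_mx.
by move: gen0; rewrite /minor => ->; rewrite raddf0.
Qed.

End Genericity.

(** * The explicit tensor *)

Section Slices.
Variables (F : fieldType) (p : nat).
Local Notation m := (2 * p + 1)%N.
Variables (x : 'I_m -> F) (i0 : 'I_m).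
Hypothesis x_inj : injective x.

(** The indices 0, ..., p form the block of size p + 1 of the slices X_i, and the
    indices p + 1, ..., 2p form the block of size p, called upper. *)
Definition upper (k : 'I_m) : bool := (p < k)%N.
Definition deg (k : 'I_m) : nat := if upper k then (k - p.+1)%N else k.
Definition deg_bound (t : bool) : nat := if t then p else p.+1.

(** Dropping i0 from the smaller block is what splits its flattening into an
    injective and a surjective part. *)
Definition active (t : bool) : {set 'I_m} := if t then [set~ i0] else setT.

Definition slice (i : 'I_m) : 'M[F]_m :=
  \matrix_(j, k) if (upper j == upper k) && (i \in active (upper j))
                 then x i ^+ (deg j + deg k) else 0.

Lemma slice_sym i : (slice i)^T = slice i.
Proof.
apply/matrixP => j k; rewrite !mxE eq_sym [(deg k + _)%N]addnC.
by case: eqP => [->|].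
Qed.

Lemma deg_inj t : {in [pred k | upper k == t] &, injective deg}.
Proof.
move=> j k /eqP hj /eqP hk; rewrite /deg hj hk; move: hj hk; rewrite /upper.
by case: t => hj hk ejk; apply/val_inj => /=; lia.
Qed.

Lemma deg_lt t k : upper k == t -> (deg k < deg_bound t)%N.
Proof.
move/eqP; rewrite /deg /deg_bound => hk; rewrite hk; move: (ltn_ord k) hk.
by rewrite /upper; case: t; lia.
Qed.

Lemma deg_onto t q : (q < deg_bound t)%N -> exists2 k, upper k = t & deg k = q.
Proof.
case: t => /= ltq.
  have ltm : (p.+1 + q < m)%N by lia.
  have up : upper (Ordinal ltm) by rewrite /upper /=; lia.
  by exists (Ordinal ltm); rewrite // /deg up /=; lia.
have ltm : (q < m)%N by lia.
have up : upper (Ordinal ltm) = false by rewrite /upper /=; lia.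
by exists (Ordinal ltm); rewrite // /deg up.
Qed.

Lemma card_upper : #|[set k | upper k]| = p.
Proof.
rewrite -sum1dep_card -(big_geq_mkord p.+1 m xpredT (fun=> 1%N)) /=.
by rewrite sum_nat_const_nat muln1; lia.
Qed.

(** Each equation of the kernel involves one block only, and for a row with
    position j in this block it is the power sum equation of exponent deg j; all
    exponents below the size of the block occur. *)
Lemma slice_sum_kernel_eq0 D D' (A : 'I_m -> 'M[F]_(D, D')) (v : 'cV[F]_(D' * m))
    (t : bool) (small : pred 'I_D) (s : 'I_D') :
  (forall i u s s', A i u s != 0 -> A i u s' != 0 -> s = s') ->
  (forall u, small u ->
    (#|[set i in active t | [exists s, A i u s != 0%R]]| <= deg_bound t)%N) ->
  (deg_bound t <=
    #|[set i in active t | [exists u, small u && (A i u s != 0%R)]]|)%N ->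
  (\sum_i tensmx (A i) (slice i)) *m v = 0 ->
  forall k, upper k = t -> v (mxtens_index (s, k)) 0 = 0.
Proof.
move=> A_inj A_small s_large Mv k hk.
apply: (koszul_kernel_eq0 x_inj (v := fun s k => v (mxtens_index (s, k)) 0)
  (@deg_inj t) (@deg_lt t) A_inj A_small s_large); last exact/eqP.
move=> u q _ /deg_onto[j hj <-].
have := sum_tensmx_mulE A slice v u j.
rewrite Mv mxE => /esym Mv0; rewrite -[RHS]Mv0.
rewrite [RHS](bigID (mem (active t))) /= [X in _ = _ + X]big1 ?addr0; last first.
  move=> i nia; rewrite big1 // => s' _; rewrite big1 ?mulr0 // => k' _.
  by rewrite mxE hj (negbTE nia) andbF mul0r.
apply: eq_bigr => i ia; rewrite mulr_sumr; apply: eq_bigr => s' _.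
rewrite mulrCA; congr (_ * _); rewrite [RHS](bigID (fun k => upper k == t)) /=.
rewrite [X in _ = _ + X]big1 ?addr0 => [|k' nk']; last first.
  by rewrite mxE hj eq_sym (negbTE nk') mul0r.
rewrite mulr_sumr; apply: eq_bigr => k' /eqP hk'.
by rewrite mxE hj hk' eqxx ia /= exprD mulrAC mulrA.
Qed.

Variables (D : nat) (s s' : D.-tuple {set 'I_m}).
Hypotheses (us : uniq s) (sE : forall A, (A \in s) = (#|A| == p)).
Hypotheses (us' : uniq s') (s'E : forall A, (A \in s') = (#|A| == p.+1)).
Variable A : 'I_m -> 'M[F]_D.
Hypothesis AE : forall i u j,
  (A i u j != 0) = (i \notin tnth s j) && (tnth s' u == i |: tnth s j).

Let card_s j : #|tnth s j| = p.
Proof. by apply/eqP; rewrite -sE mem_tnth. Qed.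

Let card_s' u : #|tnth s' u| = p.+1.
Proof. by apply/eqP; rewrite -s'E mem_tnth. Qed.

Let M := \sum_i tensmx (A i) (slice i).

Let injective_cols := [set c : 'I_(D * m) |
  ~~ upper (mxtens_unindex c).2 || (i0 \in tnth s (mxtens_unindex c).1)].
Let surjective_rows := [set r : 'I_(D * m) |
  upper (mxtens_unindex r).2 && (i0 \notin tnth s' (mxtens_unindex r).1)].

(** In the upper block i0 is removed from the points.  A column S that contains
    i0 still has p + 1 points outside it, and all its rows U contain i0, so that
    U has only p points left. *)
Lemma cols_independent (v : 'cV_(D * m)) :
  (forall c, c \notin injective_cols -> v c 0 = 0) -> M *m v = 0 -> v = 0.
Proof.
move=> v_supp Mv; apply/matrixP => c l; rewrite ord1 {l} [RHS]mxE.
have [cX|] := boolP (c \in injective_cols); last exact: v_supp.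
rewrite -[c]mxtens_unindexK; move: cX; rewrite inE.
case: (mxtens_unindex c) => j k /= cX.
pose small u := upper k ==> (i0 \in tnth s' u).
apply: (slice_sum_kernel_eq0 (t := upper k) (small := small) _ _ _ Mv) => //.
- move=> i u a a'; rewrite !AE => /andP[nia /eqP ea] /andP[nia' /eqP ea'].
  apply: (tuple_uniqP _ us); rewrite -(setU1K nia) -(setU1K nia').
  by rewrite -ea -ea'.
- move=> u u_small.
  apply: leq_trans (_ : #|tnth s' u :&: active (upper k)| <= _)%N.
    apply/subset_leq_card/subsetP => i; rewrite !inE => /andP[-> /existsP[a]].
    by rewrite AE => /andP[_ /eqP->]; rewrite setU11.
  move: u_small; rewrite /small /active.
  case: (upper k) => /= [i0u|_]; last by rewrite setIT card_s'.
  by rewrite -setDE -ltnS -(card_s' u) [in X in (_ < X)%N](cardsD1 i0) i0u.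
apply: leq_trans (_ : #|~: tnth s j| <= _)%N.
  rewrite cardsCs setCK card_s card_ord /deg_bound; case: ifP => _; lia.
apply/subset_leq_card/subsetP => i; rewrite !inE => nij.
apply/andP; split.
  rewrite /active; move: cX; case: (upper k) => //= i0j; rewrite !inE.
  by apply: contraNneq nij => ->.
have cU : #|i |: tnth s j| = p.+1 by rewrite cardsU1 nij card_s.
have [u eu] := subset_tuple_tnth s'E cU.
apply/existsP; exists u; rewrite AE nij eu eqxx /= andbT.
rewrite /small eu; apply/implyP => hk; move: cX.
by rewrite hk inE /= => ->; rewrite orbT.
Qed.

(** In the transpose the roles are exchanged: a row U avoiding i0 has p + 1
    points, and all its columns S avoid i0, so that only p points other than i0
    are left outside S. *)
Lemma rows_independent (w : 'cV_(D * m)) :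
  (forall r, r \notin surjective_rows -> w r 0 = 0) -> M^T *m w = 0 -> w = 0.
Proof.
move=> w_supp Mw; apply/matrixP => r l; rewrite ord1 {l} [RHS]mxE.
have [rY|] := boolP (r \in surjective_rows); last exact: w_supp.
rewrite -[r]mxtens_unindexK; move: rY; rewrite inE.
case: (mxtens_unindex r) => u k /= /andP[hk ni0].
have {}Mw : (\sum_i tensmx (A i)^T (slice i)) *m w = 0.
  rewrite -Mw; congr (_ *m _); rewrite raddf_sum /=; apply: eq_bigr => i _.
  by rewrite trmx_tens slice_sym.
pose small j := i0 \notin tnth s j.
apply: (slice_sum_kernel_eq0 (t := true) (small := small) _ _ _ Mw) => //.
- move=> i a u1 u2; rewrite !mxE !AE => /andP[_ /eqP e1] /andP[_ /eqP e2].
  by apply: (tuple_uniqP _ us'); rewrite e1 e2.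
- move=> a a_small; rewrite /deg_bound /active.
  apply: leq_trans (_ : #|~: (i0 |: tnth s a)| <= _)%N.
    apply/subset_leq_card/subsetP => i; rewrite !inE negb_or => /andP[-> /existsP[u1]].
    by rewrite mxE AE => /andP[].
  by rewrite cardsCs setCK cardsU1 (a_small : i0 \notin _) card_s card_ord; lia.
apply: leq_trans (_ : #|tnth s' u| <= _)%N; first by rewrite card_s'.
apply/subset_leq_card/subsetP => i iu; rewrite !inE.
apply/andP; split; first by apply: contraNneq ni0 => <-.
have cS : #|tnth s' u :\ i| = p.
  by apply/eqP; rewrite -eqSS -(card_s' u) [in X in _ == X](cardsD1 i) iu.
have [a ea] := subset_tuple_tnth sE cS.
apply/existsP; exists a; rewrite mxE AE /small ea !inE eqxx /= setD1K // eqxx andbT.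
by rewrite negb_and ni0 orbT.
Qed.

Lemma rows_cols_disjoint c r :
  c \in injective_cols -> r \in surjective_rows -> M r c = 0.
Proof.
rewrite !inE => cX /andP[hr ni0]; rewrite summxE big1 // => i _; rewrite !mxE hr.
have [/eqP -> |] := boolP (A i (mxtens_unindex r).1 (mxtens_unindex c).1 == 0).
  by rewrite mul0r.
rewrite AE => /andP[_ /eqP eU]; move: ni0; rewrite eU !inE negb_or.
case/andP=> _ ni0; move: cX; rewrite (negbTE ni0) orbF => /negbTE ->.
by rewrite mulr0.
Qed.

Lemma rank_slice_sum :
  (D * p.+1 + (D - 'C(2 * p, p)) * p + 'C(2 * p, p.+1) * p <= \rank M)%N.
Proof.
have em : m.-1 = (2 * p)%N by rewrite addn1.
have := rank_ge_cols_add_rows cols_independent rows_independent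
  rows_cols_disjoint.
apply: leq_trans; apply: leq_add.
  rewrite (card_tens_index (fun ck => ~~ upper ck.2 || (i0 \in tnth s ck.1))).
  have -> : [set ck : 'I_D * 'I_m | ~~ upper ck.2 || (i0 \in tnth s ck.1)] =
    setX setT (~: [set k | upper k]) :|:
    setX (~: [set a | i0 \notin tnth s a]) [set k | upper k].
    apply/setP => -[a k]; rewrite !inE /= negbK.
    by case: (upper k); rewrite ?andbT ?andbF ?orbF.
  rewrite cardsU !cardsX cardsT card_ord [#|~: _|]cardsCs setCK card_upper card_ord.
  rewrite [#|~: _|]cardsCs setCK (card_tuple_notin i0 us sE) card_ord em.
  set T := (_ :&: _); have -> : T = set0.
    by apply/setP => -[a k]; rewrite !inE /=; case: (upper k); rewrite ?andbF.
  by rewrite cards0 subn0 leq_add2r leq_mul2l; apply/orP; right; lia.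
rewrite (card_tens_index (fun ck => upper ck.2 && (i0 \notin tnth s' ck.1))).
have -> : [set ck : 'I_D * 'I_m | upper ck.2 && (i0 \notin tnth s' ck.1)] =
    setX [set a | i0 \notin tnth s' a] [set k | upper k].
  by apply/setP => -[a k]; rewrite !inE andbC.
by rewrite cardsX card_upper (card_tuple_notin i0 us' s'E) em.
Qed.

End Slices.

(** Let C = C(2p, p).  As (p + 1) C(2p, p - 1) = p C, the right-hand side equals
    (4p - 1 + 2 / (p + 1)) C, and the coefficient of C on the left is 4p - 2. *)
Lemma koszul_rank_arith p : (0 < p)%N ->
  ((2 * (2 * p + 1) - 4) * 'C(2 * p, p) + 1 <=
   'C(2 * p + 1, p) * p.+1 + ('C(2 * p + 1, p) - 'C(2 * p, p)) * p
   + 'C(2 * p, p.+1) * p)%N.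
Proof.
case: p => // p _.
have e1 : 'C(2 * p.+1, p.+2) = 'C(2 * p.+1, p).
  by rewrite -bin_sub; [congr 'C(_, _)|]; lia.
have e2 : 'C(2 * p.+1 + 1, p.+1) = ('C(2 * p.+1, p.+1) + 'C(2 * p.+1, p))%N.
  by rewrite addn1 binS.
have e3 : (p.+2 * 'C(2 * p.+1, p) = p.+1 * 'C(2 * p.+1, p.+1))%N.
  rewrite (mul_bin_left (2 * p.+1) p); congr (_ * _)%N; lia.
have c_pos : (0 < 'C(2 * p.+1, p.+1))%N by rewrite bin_gt0; lia.
rewrite e1 e2.
move: e3 c_pos.
move: ('C(2 * p.+1, p)) ('C(2 * p.+1, p.+1)) => B C e3 c_pos.
rewrite addKn; nia.
Qed.

(** * Vanishing on tensors of small border rank *)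

Section UpperBound.
Variables (K : fieldType) (m D : nat) (L : {linear 'rV[K]_m -> 'M[K]_D}).

HB.instance Definition _ :=
  GRing.isLinear.Build K (tensor3 K m) 'M[K]_(D * m) *:%R (phi_map L)
    (phi_map_is_linear L).

Lemma rank_phi_pure (a b c : 'rV[K]_m) :
  (\rank (phi_map L (pure_tensor a b c)) <= \rank (L a))%N.
Proof.
have -> : pure_tensor a b c = vec_mx_tensor a (b^T *m c).
  by apply/ffunP => t; rewrite !ffunE mxE big_ord1 !mxE mulrA.
by rewrite phi_map_tensor rank_tensmx_mul.
Qed.

Lemma rank_phi_sum_of_pure r n (T : tensor3 K m) :
  (forall v, (\rank (L v) <= r)%N) -> sum_of_pure n T ->
  (\rank (phi_map L T) <= n * r)%N.
Proof.
move=> rL [a [b [c ->]]]; rewrite linear_sum /=.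
have -> : (n * r = \sum_(i < n) r)%N by rewrite sum_nat_const card_ord.
elim/big_ind2: _ => [|A k B l rA rB|i _]; first by rewrite mxrank0.
  exact: leq_trans (mxrank_add _ _) (leq_add rA rB).
exact: leq_trans (rank_phi_pure _ _ _) (rL _).
Qed.

Lemma minor_phi_border_rank_eq0 r n N (f g : 'I_N -> 'I_(D * m))
    (T : tensor3 K m) :
  (forall v, (\rank (L v) <= r)%N) -> (n * r < N)%N ->
  border_rank_le n T -> minor f g (phi_map L T) = 0.
Proof.
move=> rL ltN [k [clT _] lekn]; rewrite -minor_generic_mx; apply: clT => S.
case=> l [Sl _] lelk; rewrite minor_generic_mx; apply: rank_lt_minor_eq0.
apply: leq_ltn_trans (rank_phi_sum_of_pure rL Sl) _; apply: leq_ltn_trans ltN.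
by rewrite leq_mul2r (leq_trans lelk lekn) orbT.
Qed.

End UpperBound.

(** * The equations *)

Theorem corollary6p1 (K : fieldType) (p : nat) (hp : (1 <= p)%N) :
  let m := (2 * p + 1)%N in
  let D := 'C(m, p) in
  let N := ((2 * m - 4) * 'C(2 * p, p) + 1)%N in
  forall (b b' : D.-tuple (extalg K m)),
    basis_of (extpow K m p) b -> basis_of (extpow K m p.+1) b' ->
  let phi := phi_map (wedge_mx b b') in
  (forall f g : 'I_N -> 'I_(D * m), increasing f -> increasing g ->
     forall T : tensor3 K m, border_rank_le (2 * m - 4) T ->
       minor f g (phi T) = 0)
  /\ (exists f g : 'I_N -> 'I_(D * m),
        [/\ increasing f, increasing g & minor f g (generic_mx phi) != 0]).
Proof.
move=> m D N b b' Bb Bb' phi; split=> [f g _ _ T|].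
  apply: (minor_phi_border_rank_eq0 (L := wedge_mx b b') (r := 'C(2 * p, p))).
    have -> : 'C(2 * p, p) = 'C(m.-1, p) by rewrite /m addn1.
    by move=> v; apply: rank_wedge_mx Bb Bb'.
  by rewrite /N addn1.
pose F := {fraction {poly K}}.
pose iota : {rmorphism K -> F} := @tofrac {poly K} \o polyC.
pose x (i : 'I_m) : F := tofrac ('X^i : {poly K}).
have x_inj : injective x.
  move=> i j /eqP; rewrite tofrac_eq => /eqP/(congr1 (size \o polyseq)) /=.
  by rewrite !size_polyXn => -[]; apply: val_inj.
have m_gt0 : (0 < m)%N by rewrite /m addn1.
pose i0 := Ordinal m_gt0.
have [s us sE] := exists_subset_tuple (erefl : D = 'C(m, p)).
have [|s' us' s'E] := @exists_subset_tuple m p.+1 D.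
  by rewrite /D /m -bin_sub; [congr 'C(_, _)|]; lia.
pose es := map_tuple (@ebase K m) s; pose es' := map_tuple (@ebase K m) s'.
have [P [Q PQ]] := wedge_mx_change es' Bb (ebase_basis K us sE) Bb'.
pose A i := map_mx iota (wedge_mx es es' (delta_mx 0 i)).
have AE i u j :
    (A i u j != 0) = (i \notin tnth s j) && (tnth s' u == i |: tnth s j).
  rewrite mxE (wedge_mx_ebaseE K i u j sE us' s'E) fmorph_eq0.
  by case: ifP; rewrite ?signr_eq0 ?eqxx.
apply: (@exists_generic_minor_neq0 K F iota m D (wedge_mx b b') (slice x i0)).
apply: leq_trans (koszul_rank_arith hp) _.
apply: leq_trans (rank_slice_sum i0 x_inj us sE us' s'E AE) _.
have -> : \sum_i tensmx (A i) (slice x i0 i) = tensmx (map_mx iota P) 1%:M *m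
    (\sum_i tensmx (map_mx iota (wedge_mx b b' (delta_mx 0 i))) (slice x i0 i)) *m
    tensmx (map_mx iota Q) 1%:M.
  rewrite mulmx_sumr mulmx_suml; apply: eq_bigr => i _.
  by rewrite !tensmx_mul mul1mx mulmx1 /A PQ !map_mxM.
exact: leq_trans (mxrankM_maxl _ _) (mxrankM_maxr _ _).
Qed.
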